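(* Let $n\ge1$ and let $Q_n$ be the set of vertices of the bidirectional ballot polytope $\mathcal{P}_n\subset[0,1]^{2n-1}$. For $v=[v_1,\dots,v_{2n-1}]\in Q_n$ let $\alpha(v)=[1,0,v_1,\dots,v_{2n-1},0,1]\in\{0,1\}^{2n+3}$, let $\lambda_i=(-1)^{i-1}(2\alpha(v)_i-1)\in\{\pm1\}$ for $1\le i\le 2n+3$, and let $b(v)=b_1\cdots b_{2n+3}$ be the binary sequence with $b_i=1$ if $\lambda_i=1$ and $b_i=0$ if $\lambda_i=-1$ (equivalently, the lattice path with steps $(1,\lambda_i)$ is the graph of the piecewise linear function $f_\lambda$ with $f_\lambda(0)=0$ and slope $\lambda_i$ on $(i-1,i)$). Then $v\mapsto b(v)$ is a bijection from $Q_n$ onto the set of bidirectional ballot sequences of length $2n+3$.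
   Context: A bidirectional ballot sequence is a finite 0-1 sequence such that every nonempty prefix and every nonempty suffix contains strictly more ones than zeros. Let $m=2n-1$. The left ballot vectors are $L_n=\{w_1,\dots,w_{n-1}\}\subset\mathbb{R}^m$, where $w_k$ consists of $k$ copies of the pair $(1,-1)$ followed by $m-2k$ zeros; the right ballot vectors are $R_n=\{u_1,\dots,u_{n-1}\}$, where $u_k$ consists of $m-2k$ zeros followed by $k$ copies of the pair $(-1,1)$; $V_n=L_n\cup R_n$. The bidirectional ballot polytope is $\mathcal{P}_n=\{x\in[0,1]^m: x\cdot w\ge0\ \forall w\in V_n\}$. *)

(* Defs.v *)
From mathcomp Require Import all_boot all_order all_algebra.
From mathcomp Require Import boolp classical_sets functions reals.

Set Implicit Arguments.
Unset Strict Implicit.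
Unset Printing Implicit Defensive.

Import Order.TTheory GRing.Theory Num.Theory.

Local Open Scope classical_set_scope.
Local Open Scope ring_scope.

Definition more_ones (s : seq bool) : bool :=
  (count_mem false s < count_mem true s)%N.

Definition bidirectional_ballot (s : seq bool) : Prop :=
  forall p : seq bool, p <> [::] -> prefix p s \/ suffix p s -> more_ones p.

Definition bidirectional_ballot_sequences (l : nat) : set (seq bool) :=
  [set s | size s = l /\ bidirectional_ballot s].

Definition ballot_dim (n : nat) : nat := (2 * n - 1)%N.

Section Polytope.
Variables (R : realType) (n : nat).

Local Notation m := (ballot_dim n).

Definition row_of_seq (s : seq R) : 'rV[R]_m := \row_(j < m) s`_j.

Definition left_ballot_vector (k : nat) : 'rV[R]_m :=
  row_of_seq (flatten (nseq k [:: 1; -1]) ++ nseq (m - 2 * k)%N 0).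

Definition right_ballot_vector (k : nat) : 'rV[R]_m :=
  row_of_seq (nseq (m - 2 * k)%N 0 ++ flatten (nseq k [:: -1; 1])).

Definition left_ballot_vectors : set 'rV[R]_m :=
  [set left_ballot_vector k | k in [set k | (1 <= k <= n - 1)%N]].

Definition right_ballot_vectors : set 'rV[R]_m :=
  [set right_ballot_vector k | k in [set k | (1 <= k <= n - 1)%N]].

Definition ballot_vectors : set 'rV[R]_m :=
  left_ballot_vectors `|` right_ballot_vectors.

Definition dot (x y : 'rV[R]_m) : R := \sum_(j < m) x 0 j * y 0 j.

Definition ballot_polytope : set 'rV[R]_m :=
  [set x : 'rV[R]_m | (forall j : 'I_m, 0 <= x 0 j <= 1) /\
                    (forall w, ballot_vectors w -> 0 <= dot x w)].

End Polytope.

(* Vertices of a convex set, as its extreme points. *)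
Definition vertices (R : realType) (d : nat) (P : set 'rV[R]_d) :
    set 'rV[R]_d :=
  [set v : 'rV[R]_d | P v /\
     forall (x y : 'rV[R]_d) (t : R), P x -> P y -> 0 < t < 1 ->
       v = t *: x + (1 - t) *: y -> x = v /\ y = v].

Definition ballot_vertices (R : realType) (n : nat) :
  set 'rV[R]_(ballot_dim n) := vertices (@ballot_polytope R n).

Section Word.
Variables (R : realType) (n : nat).

Definition alpha (v : 'rV[R]_(ballot_dim n)) : seq R :=
  [:: 1; 0] ++ [seq v 0 j | j <- enum 'I_(ballot_dim n)] ++ [:: 0; 1].

(* Positions are counted from 0 here, so [lambda v i] is the usual
   lambda_{i+1} and its sign (-1)^((i+1)-1) is (-1)^i. *)
Definition lambda (v : 'rV[R]_(ballot_dim n)) (i : nat) : R :=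
  (-1) ^+ i * (2 * (alpha v)`_i - 1).

(* The bit is [false] whenever lambda is not 1, so that the word is defined
   for every real v; it has the intended meaning when lambda is 1 or -1. *)
Definition ballot_word (v : 'rV[R]_(ballot_dim n)) : seq bool :=
  mkseq (fun i => lambda v i == 1) (2 * n + 3)%N.

End Word.

(* Main.v *)
Require Import Defs.
From mathcomp Require Import all_boot all_order all_algebra.
From mathcomp Require Import boolp classical_sets functions reals.
From mathcomp Require Import archimedean zify ring lra.

(** Write [S_k] for the alternating partial sums of [v]. The polytope is cut out
    by integer bounds on differences of the [S_k]: [S_k - S_(k-1)] lies in [[0,1]]
    or [[-1,0]] according to parity, [S_k >= S_0] for even [k], and [S_k <= S_m]
    for odd [k]. If some [S_j] is not an integer, moving every [S_k] congruent to
    [S_j] modulo the integers by a small amount in either direction stays in the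
    polytope, so vertices are 0-1 vectors; conversely a 0-1 point of the polytope
    is a vertex of the cube. For a 0-1 vector, the lattice path of the word has
    height [2 + 2 S_k - (k mod 2)] after [k + 2] steps and final height
    [2 S_m + 3], so that membership in the polytope amounts to the path staying
    strictly above its start and strictly below its end. *)

Set Implicit Arguments.
Unset Strict Implicit.
Unset Printing Implicit Defensive.

Import Order.TTheory GRing.Theory Num.Theory.

Local Open Scope classical_set_scope.
Local Open Scope ring_scope.

(** * Perturbations preserving integer bounds on differences *)

Lemma exists_pos_lower_bound (R : realDomainType) (I : finType) (F : I -> R) :
  (forall i, 0 < F i) -> exists2 e : R, 0 < e & forall i, e <= F i.
Proof.
move=> F0; exists (\big[Num.min/1]_i F i).
  by elim/big_rec: _ => // i x _ x0; rewrite lt_min F0.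
by move=> i; rewrite (bigD1 i) //= ge_min lexx.
Qed.

(** The slack is the fractional part of [r]: an integer below [r] is at most its floor. For integral
    [r] the value 1 is a placeholder, which keeps the slack positive in all cases. *)
Lemma exists_nonint_slack (R : realType) (r : R) : exists2 e : R, 0 < e &
  r \isn't a Num.int -> forall c : int, c%:~R <= r -> c%:~R + e <= r.
Proof.
have [ri|rNi] := boolP (r \is a Num.int); first by exists 1.
exists (r - (Num.floor r)%:~R).
  rewrite subr_gt0 lt_neqAle floor_le andbT.
  by apply: contra rNi => /eqP <-; rewrite intr_int.
move=> _ c; rewrite -floor_ge_int -(ler_int R) => ?.
by lra.
Qed.

(** The shift [d] goes exactly to the values congruent to [f j] modulo the integers. If both or
    neither of [f a], [f b] move, their difference is unchanged. If exactly one moves, the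
    difference is not an integer, so every integer bound on it has slack; [e] is the least slack
    over the finitely many pairs. *)
Lemma int_diff_perturbation (R : realType) (N : nat) (f : nat -> R) (j : nat) :
  exists2 e : R, 0 < e & forall d : R, `|d| <= e ->
    forall (a b : nat) (c : int), (a <= N)%N -> (b <= N)%N ->
    c%:~R <= f a - f b ->
    c%:~R <= f a + d *+ (f a - f j \is a Num.int)
           - (f b + d *+ (f b - f j \is a Num.int)).
Proof.
pose slack (p : 'I_N.+1 * 'I_N.+1) :=
  sval (cid2 (exists_nonint_slack (f p.1 - f p.2))).
have [p|e e0 le_e] := @exists_pos_lower_bound R _ slack.
  by rewrite /slack; case: cid2.
exists e => // d; rewrite ler_norml => /andP[d1 d2] a b c aN bN cab.
have strict : f a - f b \isn't a Num.int -> c%:~R + e <= f a - f b.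
  move=> abNi; have := le_e (Ordinal (aN : (a < N.+1)%N), Ordinal (bN : (b < N.+1)%N)).
  rewrite /slack; case: cid2 => /= s s0 /(_ abNi c cab) ? ?; by lra.
have [ai|aNi] := boolP (f a - f j \is a Num.int);
have [bi|bNi] := boolP (f b - f j \is a Num.int); rewrite ?mulr1n ?mulr0n.
- by lra.
- suff /strict ? : f a - f b \isn't a Num.int by lra.
  apply: contra bNi => abi; have -> : f b - f j = (f a - f j) - (f a - f b) by ring.
  exact: rpredB.
- suff /strict ? : f a - f b \isn't a Num.int by lra.
  apply: contra aNi => abi; have -> : f a - f j = (f a - f b) + (f b - f j) by ring.
  exact: rpredD.
- by lra.
Qed.

(** * The polytope in terms of alternating partial sums *)

Section Potential.
Variables (R : realType) (n : nat).
Local Notation m := (ballot_dim n).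
Implicit Types (v : 'rV[R]_m) (f : nat -> R).

(** Indexing by naturals, with value 0 from [m] on, lets partial sums run over intervals of
    naturals. *)
Definition coord v (i : nat) : R := [seq v 0 j | j <- enum 'I_m]`_i.

Lemma coord_ord v (j : 'I_m) : coord v j = v 0 j.
Proof.
by rewrite /coord (nth_map j) ?size_enum_ord// nth_ord_enum.
Qed.

Lemma coord_inj v w : (forall i, (i < m)%N -> coord v i = coord w i) -> v = w.
Proof.
by move=> vw; apply/rowP => j; rewrite -!coord_ord vw.
Qed.

Definition alt_sum v (k : nat) : R := \sum_(0 <= i < k) (-1) ^+ i * coord v i.

(** A signed discrete derivative: it inverts [alt_sum], and the potential is recovered from it up to
    the constant [f 0]. *)
Definition row_of_potential f : 'rV[R]_m :=
  \row_j ((-1) ^+ j * (f j.+1 - f j)).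

Lemma coord_row_of_potential f i : (i < m)%N ->
  coord (row_of_potential f) i = (-1) ^+ i * (f i.+1 - f i).
Proof. by move=> im; rewrite (coord_ord _ (Ordinal im)) mxE. Qed.

Lemma row_of_potential_alt_sum v : row_of_potential (alt_sum v) = v.
Proof.
apply: coord_inj => i im; rewrite coord_row_of_potential//.
by rewrite /alt_sum big_nat_recr//= [X in X - _]addrC addrK signrMK.
Qed.

Lemma alt_sum_row_of_potential f k : (k <= m)%N ->
  alt_sum (row_of_potential f) k = f k - f 0%N.
Proof.
elim: k => [|k IH] km; first by rewrite /alt_sum big_nil subrr.
rewrite /alt_sum big_nat_recr//= -/(alt_sum _ _) IH ?(ltnW km)//.
by rewrite coord_row_of_potential// signrMK; ring.
Qed.

Lemma nth_flatten_alternating (a : R) k i :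
  (flatten (nseq k [:: a; - a]))`_i = if (i < 2 * k)%N then (-1) ^+ i * a else 0.
Proof.
elim: k i => [i|k IH [|[|i]]]; first by rewrite muln0 nth_nil.
- by rewrite mulnS mul1r.
- by rewrite mulnS expr1 mulN1r.
- rewrite /= IH; have -> : (i.+2 < 2 * k.+1)%N = (i < 2 * k)%N by lia.
  by rewrite !exprS !mulN1r opprK.
Qed.

Lemma size_flatten_nseq2 (a b : R) k : size (flatten (nseq k [:: a; b])) = (2 * k)%N.
Proof. by elim: k => //= k ->; lia. Qed.

Lemma dot_left_ballot_vector v k : (1 <= k <= n - 1)%N ->
  dot v (left_ballot_vector R n k) = alt_sum v (2 * k).
Proof.
move=> kn; have km : (2 * k <= m)%N by rewrite /ballot_dim; lia.
rewrite /dot /alt_sum (big_nat_widen _ _ _ _ _ km) big_mkord [RHS]big_mkcond/=.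
apply: eq_bigr => j _; rewrite mxE nth_cat size_flatten_nseq2.
rewrite nth_flatten_alternating -coord_ord.
by case: ltnP => _; rewrite ?mulr1 1?mulrC// nth_nseq if_same mul0r.
Qed.

Lemma dot_right_ballot_vector v k : (1 <= k <= n - 1)%N ->
  dot v (right_ballot_vector R n k) = alt_sum v m - alt_sum v (m - 2 * k).
Proof.
move=> kn.
rewrite /alt_sum (@big_cat_nat _ _ _ (m - 2 * k)%N 0%N m)//= ?leq_subr//.
rewrite [X in X - _]addrC addrK (big_nat_widenl _ 0%N)// big_mkord [RHS]big_mkcond/= /dot.
apply: eq_bigr => j _; rewrite mxE nth_cat size_nseq.
rewrite -[X in [:: -1; X]](@opprK R) nth_flatten_alternating -coord_ord.
case: ltnP => jm /=; first by rewrite nth_nseq jm mulr0.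
have jm' := ltn_ord j.
have -> : (j - (m - 2 * k) < 2 * k)%N by lia.
rewrite mulrN1 mulrC -signr_odd -[in RHS]signr_odd.
(* Since [m] is odd, the nonzero block starts at the odd index [m - 2 * k], so its pattern -1, 1
   agrees with the signs of [alt_sum]. *)
have -> : odd j = ~~ odd (j - (m - 2 * k)) by move: jm'; rewrite /ballot_dim in jm *; lia.
by case: odd; rewrite ?expr0 ?expr1 ?opprK.
Qed.

(** As [m] is odd, the even indices [k] up to [m] are 0 and the lengths of the nonzero blocks of the
    left vectors. The odd ones are [m] and the starting points of the blocks of the right vectors.
    The conditions at 0 and [m] are trivial. *)
Lemma ballot_polytopeP v : (1 <= n)%N -> ballot_polytope v <->
  [/\ forall i, (i < m)%N -> 0 <= coord v i <= 1,
      forall k, (k <= m)%N -> ~~ odd k -> 0 <= alt_sum v k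
    & forall k, (k <= m)%N -> odd k -> alt_sum v k <= alt_sum v m].
Proof.
move=> n1; have mE : m = (2 * n - 1)%N by [].
split=> [[v01 vw]|[v01 v_even v_odd]].
  split=> [i im|k km kodd|k km kodd].
  - by rewrite (coord_ord v (Ordinal im)).
  - have [->|k0] := eqVneq k 0%N; first by rewrite /alt_sum big_nil.
    have kE : k = (2 * k./2)%N by lia.
    have kn : (1 <= k./2 <= n - 1)%N by lia.
    rewrite kE -dot_left_ballot_vector//.
    by apply: vw; left; exists k./2.
  - have [->//|kNm] := eqVneq k m.
    have kE : k = (m - 2 * (m - k)./2)%N by lia.
    have kn : (1 <= (m - k)./2 <= n - 1)%N by lia.
    rewrite -subr_ge0 kE -dot_right_ballot_vector//.
    by apply: vw; right; exists (m - k)./2.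
split=> [j|w [|] [k /= kn <-]]; first by rewrite -coord_ord v01.
  by rewrite dot_left_ballot_vector// v_even//; lia.
by rewrite dot_right_ballot_vector// subr_ge0 v_odd//; lia.
Qed.

Lemma ballot_polytope_potential f : (1 <= n)%N ->
  ballot_polytope (row_of_potential f) <->
  [/\ forall i, (i < m)%N -> 0 <= (-1) ^+ i * (f i.+1 - f i) <= 1,
      forall k, (k <= m)%N -> ~~ odd k -> 0 <= f k - f 0%N
    & forall k, (k <= m)%N -> odd k -> 0 <= f m - f k].
Proof.
move=> n1; rewrite ballot_polytopeP//.
split=> -[f01 f_even f_odd]; split=> [i im|k km kodd|k km kodd].
- by have := f01 i im; rewrite coord_row_of_potential.
- by have := f_even k km kodd; rewrite alt_sum_row_of_potential.
- have := f_odd k km kodd; rewrite !alt_sum_row_of_potential// => ?; by lra.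
- by rewrite coord_row_of_potential// f01.
- by rewrite alt_sum_row_of_potential// f_even.
- have := f_odd k km kodd; rewrite !alt_sum_row_of_potential// => ?; by lra.
Qed.

(** Every constraint bounds a difference of potentials below by 0 or -1: an upper bound 1 on an
    increment is the lower bound -1 on the opposite difference. *)
Lemma ballot_polytope_perturbation f g : (1 <= n)%N ->
  (forall (a b : nat) (c : int), (a <= m)%N -> (b <= m)%N ->
     c%:~R <= f a - f b -> c%:~R <= g a - g b) ->
  ballot_polytope (row_of_potential f) -> ballot_polytope (row_of_potential g).
Proof.
move=> n1 fg; rewrite !ballot_polytope_potential// => -[f01 f_even f_odd].
split=> [i im|k km kodd|k km kodd]; last 2 first.
- by apply: (fg _ _ 0); rewrite ?f_even.
- by apply: (fg _ _ 0); rewrite ?f_odd.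
have := f01 i im; rewrite -signr_odd.
case: odd; rewrite ?expr0 ?expr1 ?mul1r ?mulN1r => /andP[fi0 fi1].
  have := fg i i.+1 0 (ltnW im) im; have := fg i.+1 i (-1) im (ltnW im).
  by rewrite mulrNz => h1 h0; apply/andP; split; [have := h0 _|have := h1 _]; lra.
have := fg i.+1 i 0 im (ltnW im); have := fg i i.+1 (-1) (ltnW im) im.
by rewrite mulrNz => h1 h0; apply/andP; split; [have := h0 _|have := h1 _]; lra.
Qed.

(** * Vertices are the 0-1 points *)

Definition zero_one v := forall i, (i < m)%N -> coord v i = 0 \/ coord v i = 1.

Lemma zero_one_vertex v : ballot_polytope v -> zero_one v -> ballot_vertices v.
Proof.
move=> Pv v01; split=> // x y t [x01 _] [y01 _] /andP[t0 t1] vE.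
have conv0 (a b : R) : 0 <= a -> 0 <= b -> t * a + (1 - t) * b = 0 -> a = 0 /\ b = 0.
  move=> a0 b0 /eqP; rewrite paddr_eq0 ?mulr_ge0//; [|by lra..].
  have t1' : 0 < 1 - t by lra.
  rewrite !mulf_eq0 (gt_eqF t0) (gt_eqF t1') /=.
  by move=> /andP[/eqP -> /eqP ->].
have xyE j : x 0 j = v 0 j /\ y 0 j = v 0 j.
  move/rowP/(_ j): vE; rewrite !mxE.
  have := v01 j (ltn_ord j); rewrite coord_ord.
  have /andP[] := x01 j; have /andP[] := y01 j.
  move=> y0 y1 x0 x1 [] -> h; first exact: conv0.
  (* The value 1 reduces to the value 0 by the reflection of the unit interval. *)
  by have [|||? ?] := conv0 (1 - x 0 j) (1 - y 0 j); lra.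
by split; apply/rowP => j; have [] := xyE j.
Qed.

(** Otherwise [v] is the midpoint of the two points obtained by shifting the class of [alt_sum v j]
    by [e] and by [- e], so extremality makes both equal to [v]. *)
Lemma vertex_alt_sum_int v j : (1 <= n)%N -> ballot_vertices v -> (j <= m)%N ->
  alt_sum v j \is a Num.int.
Proof.
move=> n1 [Pv ext] jm; apply/negPn/negP => jNi.
have [e e0 pert] := int_diff_perturbation m (alt_sum v) j.
pose g (d : R) k := alt_sum v k + d *+ (alt_sum v k - alt_sum v j \is a Num.int).
have Pg d : `|d| <= e -> ballot_polytope (row_of_potential (g d)).
  move=> de; apply: (@ballot_polytope_perturbation (alt_sum v)) => //.
    exact: pert.
  by rewrite row_of_potential_alt_sum.
have half : 0 < (2^-1 : R) < 1 by lra.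
have Pge : ballot_polytope (row_of_potential (g e)) by apply: Pg; rewrite gtr0_norm.
have PgNe : ballot_polytope (row_of_potential (g (- e))).
  by apply: Pg; rewrite normrN gtr0_norm.
have [|gE _] := ext _ _ _ Pge PgNe half.
  apply: coord_inj => i im.
  rewrite -[in LHS](row_of_potential_alt_sum v) (coord_ord _ (Ordinal im)).
  rewrite [in RHS](coord_ord _ (Ordinal im)) !mxE /g !mulNrn /=.
  set a := (-1) ^+ i; set b := e *+ _; set c := e *+ _; by field.
(* The potential at 0 is 0, which is outside the class of [alt_sum v j] and stays fixed, whereas the
   one at [j] gains [e]; equality with [v] then forces [e = 0]. *)
have := alt_sum_row_of_potential (g e) jm.
rewrite gE /g subrr rpred0 mulr1n /alt_sum big_nil -/(alt_sum v j) sub0r rpredN.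
by rewrite (negPf jNi) mulr0n => ?; lra.
Qed.

(** Each coordinate is, up to sign, a difference of consecutive integral partial sums, hence an
    integer in the unit interval. *)
Lemma vertex_zero_one v : (1 <= n)%N -> ballot_vertices v -> zero_one v.
Proof.
move=> n1 Vv i im.
have /ballot_polytopeP -/(_ n1)[/(_ i im) /andP[vi0 vi1] _ _] : ballot_polytope v.
  by case: Vv.
have /intrP[c cE] : coord v i \is a Num.int.
  rewrite -(row_of_potential_alt_sum v) coord_row_of_potential// rpredM ?rpredX ?rpredN ?rpred1//.
  by rewrite rpredB// vertex_alt_sum_int// ltnW.
move: vi0 vi1; rewrite cE ler0z -[1]/(1%:~R) ler_int => c0 c1.
have : c = 0 \/ c = 1 by lia.
by case=> ->; [left|right].
Qed.

End Potential.

(** * Ballot conditions as bounds on path heights *)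

Section Height.
Variable R : realType.
Implicit Type s : seq bool.

Definition height s (k : nat) : R := \sum_(0 <= i < k) (-1) ^+ (~~ nth false s i).

Lemma height0 s : height s 0 = 0.
Proof. exact: big_nil. Qed.

Lemma heightS s k : height s k.+1 = height s k + (-1) ^+ (~~ nth false s k).
Proof. by rewrite /height big_nat_recr. Qed.

Lemma height_take s k : (k <= size s)%N -> height s k =
  (count_mem true (take k s))%:R - (count_mem false (take k s))%:R.
Proof.
elim: k => [|k IH] ks; first by rewrite height0 take0 subrr.
rewrite heightS IH 1?ltnW// (take_nth false)// -cats1 !count_cat !natrD /=.
by case: nth => /=; ring.
Qed.

Lemma more_ones_take s k : (k <= size s)%N ->
  more_ones (take k s) = (0 < height s k).
Proof. by move=> ks; rewrite height_take// subr_gt0 ltr_nat. Qed.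

Lemma more_ones_drop s k : (k <= size s)%N ->
  more_ones (drop k s) = (height s k < height s (size s)).
Proof.
move=> ks; rewrite !height_take// take_size -[in RHS](cat_take_drop k s).
rewrite !count_cat take_size_cat ?size_takel// !natrD /more_ones -(ltr_nat R).
by apply/idP/idP => ?; lra.
Qed.

Lemma bidirectional_ballotP s : bidirectional_ballot s <->
  (forall k, (0 < k <= size s)%N -> 0 < height s k) /\
  (forall k, (k < size s)%N -> height s k < height s (size s)).
Proof.
split=> [sb|[spre ssuf] p p0 [/prefixP[t sE]|/suffixP[t sE]]].
- split=> k ks; [rewrite -more_ones_take; last by lia|rewrite -more_ones_drop 1?ltnW//].
    apply: sb; last by left; exact: prefix_take.
    by move/(congr1 size); rewrite size_takel/=; lia.
  apply: sb; last by right; exact: suffix_drop.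
  by move/(congr1 size); rewrite size_drop/=; lia.
- have p_gt0 : (0 < size p)%N by case: p p0 {sE}.
  have -> : p = take (size p) s by rewrite sE take_size_cat.
  have ps : (size p <= size s)%N by rewrite sE size_cat leq_addr.
  by rewrite more_ones_take// spre// p_gt0.
- have p_gt0 : (0 < size p)%N by case: p p0 {sE}.
  have -> : p = drop (size t) s by rewrite sE drop_size_cat.
  have ts : (size t < size s)%N by rewrite sE size_cat -[ltnLHS]addn0 ltn_add2l.
  by rewrite more_ones_drop 1?ltnW// ssuf.
Qed.

End Height.

(** * Coding 0-1 vectors by ballot words *)

Section Coding.
Variables (R : realType) (n : nat).
Hypothesis n_gt0 : (1 <= n)%N.
Local Notation m := (ballot_dim n).
Implicit Types (v : 'rV[R]_m) (s : seq bool).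

Let mE : (2 * n + 3)%N = m.+4. Proof. by rewrite /ballot_dim; lia. Qed.
Let odd_m : odd m. Proof. by rewrite /ballot_dim; lia. Qed.

Lemma size_alpha v : size (alpha v) = (2 * n + 3)%N.
Proof. by rewrite mE /alpha /= size_cat size_map size_enum_ord addn2. Qed.

Lemma alpha_coord v i : (i < m)%N -> (alpha v)`_i.+2 = coord v i.
Proof. by move=> im; rewrite /alpha /= nth_cat size_map size_enum_ord im. Qed.

Lemma alpha_penultimate v : (alpha v)`_m.+2 = 0.
Proof. by rewrite /alpha /= nth_cat size_map size_enum_ord ltnn subnn. Qed.

Lemma alpha_last v : (alpha v)`_m.+3 = 1.
Proof. by rewrite /alpha /= nth_cat size_map size_enum_ord ltnNge leqnSn subSnn. Qed.

Lemma index_cases (P : nat -> Prop) : P 0%N -> P 1%N ->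
  (forall i, (i < m)%N -> P i.+2) -> P m.+2 -> P m.+3 ->
  forall i, (i < 2 * n + 3)%N -> P i.
Proof.
move=> P0 P1 PSS Pm2 Pm3 [|[|i]]// im.
have [/PSS//|im'] := ltnP i m.
have : i = m \/ i = m.+1 by lia.
by case=> ->.
Qed.

Lemma alpha_zero_one v : zero_one v -> forall i, (i < 2 * n + 3)%N ->
  (alpha v)`_i = 0 \/ (alpha v)`_i = 1.
Proof.
move=> v01; apply: index_cases => [||i im||].
- by right.
- by left.
- by rewrite alpha_coord//; exact: v01.
- by left; exact: alpha_penultimate.
- by right; exact: alpha_last.
Qed.

Lemma lambda0 v : lambda v 0 = 1.
Proof. by rewrite /lambda /=; ring. Qed.

Lemma lambda1 v : lambda v 1 = 1.
Proof. by rewrite /lambda /=; ring. Qed.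

Lemma lambda_coord v i : (i < m)%N ->
  lambda v i.+2 = 2 * ((-1) ^+ i * coord v i) - (-1) ^+ i.
Proof. by move=> im; rewrite /lambda alpha_coord// !exprS; ring. Qed.

Lemma lambda_penultimate v : lambda v m.+2 = 1.
Proof.
by rewrite /lambda alpha_penultimate -signr_odd /= odd_m /= expr1; ring.
Qed.

Lemma lambda_last v : lambda v m.+3 = 1.
Proof. by rewrite /lambda alpha_last -signr_odd /= odd_m /= expr0; ring. Qed.

Lemma lambda_sign v : zero_one v -> forall i, (i < 2 * n + 3)%N ->
  lambda v i = 1 \/ lambda v i = -1.
Proof.
move=> v01 i im; rewrite /lambda -signr_odd.
have [->|->] := alpha_zero_one v01 im; case: odd; rewrite ?expr0 ?expr1.
- by left; ring.
- by right; ring.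
- by right; ring.
- by left; ring.
Qed.

Lemma nth_ballot_word v i : (i < 2 * n + 3)%N ->
  nth false (ballot_word v) i = (lambda v i == 1).
Proof. by move=> im; rewrite nth_mkseq. Qed.

Lemma sign_ballot_word v i : zero_one v -> (i < 2 * n + 3)%N ->
  (-1) ^+ (~~ nth false (ballot_word v) i) = lambda v i.
Proof.
move=> v01 im; rewrite nth_ballot_word//.
have [->|->] := lambda_sign v01 im; first by rewrite eqxx.
by have /negPf -> : -1 != 1 :> R by apply/eqP => ?; lra.
Qed.

(** The leading 2 comes from the two initial up steps. By [lambda_coord] each later step adds twice
    a term of [alt_sum] minus an alternating sign, and these signs sum to the parity of [k]. *)
Lemma height_ballot_word v k : zero_one v -> (k <= m)%N ->
  height R (ballot_word v) k.+2 = 2 + 2 * alt_sum v k - (odd k)%:R.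
Proof.
move=> v01; elim: k => [_|k IH km].
  by rewrite !heightS height0 !sign_ballot_word ?mE// lambda0 lambda1 /alt_sum big_nil /=; ring.
rewrite heightS IH 1?ltnW// sign_ballot_word ?mE ?ltnS 1?ltnW//; last by rewrite ltnS ltnW.
rewrite lambda_coord// /alt_sum big_nat_recr//= -(signr_odd R k).
by case: odd; rewrite ?expr0 ?expr1/=; ring.
Qed.

Lemma height_ballot_word_penultimate v : zero_one v ->
  height R (ballot_word v) m.+3 = 2 * alt_sum v m + 2.
Proof.
move=> v01; rewrite heightS height_ballot_word// odd_m sign_ballot_word ?mE//.
by rewrite lambda_penultimate /=; ring.
Qed.

Lemma height_ballot_word_size v : zero_one v ->
  height R (ballot_word v) (2 * n + 3) = 2 * alt_sum v m + 3.
Proof.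
move=> v01; rewrite mE heightS height_ballot_word_penultimate//.
by rewrite sign_ballot_word ?mE// lambda_last; ring.
Qed.

Lemma zero_one_alt_sum_int v k : zero_one v -> (k <= m)%N ->
  alt_sum v k \is a Num.int.
Proof.
move=> v01 km; rewrite /alt_sum big_nat rpred_sum// => i /andP[_ ik].
rewrite rpredM ?rpredX ?rpredN ?rpred1//.
by have [->|->] := v01 i (leq_trans ik km); rewrite ?rpred0 ?rpred1.
Qed.

(** This turns the strict inequalities of the path, halved, into the weak inequalities of the
    polytope. *)
Lemma int_gtN1_ge0 (x : R) : x \is a Num.int -> -1 < x -> 0 <= x.
Proof. by move=> /intrP[c ->]; rewrite -[-1]/((-1)%:~R) ltr_int ler0z; lia. Qed.

Lemma alt_sumS v k : alt_sum v k.+1 = alt_sum v k + (-1) ^+ k * coord v k.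
Proof. by rewrite /alt_sum big_nat_recr. Qed.

Lemma ballot_polytope_word v : zero_one v ->
  ballot_polytope v <-> bidirectional_ballot (ballot_word v).
Proof.
move=> v01; rewrite ballot_polytopeP// (bidirectional_ballotP R) size_mkseq.
rewrite height_ballot_word_size//.
have c01 i : (i < m)%N -> 0 <= coord v i <= 1.
  by move=> im; have [->|->] := v01 i im; rewrite ?lexx ler01.
split=> [[_ v_even v_odd]|[pre suf]]; last first.
  split=> // k km kodd.
    apply: int_gtN1_ge0; first exact: zero_one_alt_sum_int.
    have := pre k.+2; rewrite height_ballot_word// (negPf kodd) mE => h.
    have /h /= : (0 < k.+2 <= m.+4)%N by lia.
    by lra.
  rewrite -subr_ge0 int_gtN1_ge0 ?rpredB ?zero_one_alt_sum_int//.
  have := suf k.+2; rewrite height_ballot_word// kodd mE => h.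
  have /h /= : (k.+2 < m.+4)%N by lia.
  by lra.
(* The bound for even indices extends to odd ones, since the step into an odd index adds a
   nonnegative coordinate. *)
have ge0 k : (k <= m)%N -> 0 <= alt_sum v k.
  case: k => [|k] km; first by rewrite /alt_sum big_nil.
  have [kodd|kodd] := boolP (odd k.+1); last exact: v_even.
  rewrite alt_sumS -signr_odd; move: kodd => /= kodd; rewrite (negPf kodd) mul1r.
  by rewrite addr_ge0 ?v_even 1?ltnW//; case/andP: (c01 k km).
(* Dually, the step into an even index subtracts a nonnegative coordinate. *)
have leT k : (k <= m)%N -> alt_sum v k <= alt_sum v m.
  case: k => [|k] km; first by rewrite [leLHS]big_nil ge0.
  have [kodd|kodd] := boolP (odd k.+1); first exact: v_odd.
  rewrite alt_sumS -signr_odd; move: kodd => /=; rewrite negbK => kodd.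
  rewrite kodd expr1 mulN1r; have := v_odd k (ltnW km) kodd.
  by have /andP[] := c01 k km; lra.
have odd01 k : 0 <= ((odd k)%:R : R) <= 1 by case: odd; rewrite lexx ler01.
split.
- case=> [|[|k]]//; first by rewrite heightS height0 sign_ballot_word ?mE// lambda0 add0r.
  move=> km; have : (k <= m)%N \/ k = m.+1 \/ k = m.+2 by lia.
  case=> [km'|[->|->]].
  + by rewrite height_ballot_word//; have := ge0 k km'; have /andP[] := odd01 k; lra.
  + by rewrite height_ballot_word_penultimate//; have := ge0 m (leqnn _); lra.
  + by rewrite -mE height_ballot_word_size//; have := ge0 m (leqnn _); lra.
- have T0 := ge0 m (leqnn _).
  case=> [|[|k]]; first by rewrite height0; lra.
    by rewrite heightS height0 sign_ballot_word ?mE// lambda0; lra.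
  move=> km; have : (k <= m)%N \/ k = m.+1 by lia.
  case=> [km'|->].
  + by rewrite height_ballot_word//; have := leT k km'; have /andP[] := odd01 k; lra.
  + by rewrite height_ballot_word_penultimate//; lra.
Qed.

(** For a 0-1 vector, [lambda v i.+2] is 1 exactly when coordinate [i] is 1 with [i] even or 0 with
    [i] odd, so the coordinate is the bit flipped at odd [i]. *)
Definition ballot_decode s : 'rV[R]_m := \row_j (nth false s j.+2 (+) odd j)%:R.

Lemma coord_ballot_decode s i : (i < m)%N ->
  coord (ballot_decode s) i = (nth false s i.+2 (+) odd i)%:R.
Proof. by move=> im; rewrite (coord_ord _ (Ordinal im)) mxE. Qed.

Lemma zero_one_ballot_decode s : zero_one (ballot_decode s).
Proof.
by move=> i im; rewrite coord_ballot_decode//; case: addb; [right|left].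
Qed.

Lemma ballot_wordK v : zero_one v -> ballot_decode (ballot_word v) = v.
Proof.
move=> v01; apply: coord_inj => i im.
have im' : (i.+2 < 2 * n + 3)%N by lia.
rewrite coord_ballot_decode// nth_ballot_word// lambda_coord// -(signr_odd R i).
have [->|->] := v01 i im; case: odd; rewrite ?expr0 ?expr1.
- by have /eqP -> : 2 * (-1 * 0) - -1 = 1 :> R by ring.
- by have /negPf -> : 2 * (1 * 0) - 1 != 1 :> R by apply/eqP => ?; lra.
- by have /negPf -> : 2 * (-1 * 1) - -1 != 1 :> R by apply/eqP => ?; lra.
- by have /eqP -> : 2 * (1 * 1) - 1 = 1 :> R by ring.
Qed.

(** Decoding ignores the two bits at each end, so these must be forced to be ones: a down step among
    the first two brings the path back to its starting height or below, and symmetrically at the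
    end. *)
Lemma ballot_decodeK s : size s = (2 * n + 3)%N -> bidirectional_ballot s ->
  ballot_word (ballot_decode s) = s.
Proof.
move=> sn /(bidirectional_ballotP R)[pre suf].
have bit (b : bool) (x y : R) : x = y + (-1) ^+ (~~ b) -> y < x -> b.
  by case: b => //= -> ; rewrite expr1; lra.
have s0 : nth false s 0.
  by apply: (bit _ _ _ (heightS R s 0)); rewrite height0 pre// sn; lia.
have s1 : nth false s 1.
  have := pre 2%N; rewrite sn mE => /(_ isT); rewrite !heightS height0 s0.
  by case: nth => //=; rewrite expr0 expr1; lra.
have sm3 : nth false s m.+3.
  by apply: (bit _ _ _ (heightS R s m.+3)); rewrite -mE -sn suf// sn mE.
have sm2 : nth false s m.+2.
  have := suf m.+2; rewrite sn mE => /(_ (leqnSn _)); rewrite (heightS _ _ m.+3) (heightS _ _ m.+2) sm3.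
  by case: (nth _ _ m.+2) => //=; rewrite expr0 expr1; lra.
apply: (@eq_from_nth _ false); first by rewrite size_mkseq.
rewrite size_mkseq => i im; rewrite nth_ballot_word//.
move: i im; apply: index_cases => [||i im||].
- by rewrite lambda0 eqxx s0.
- by rewrite lambda1 eqxx s1.
- rewrite lambda_coord// coord_ballot_decode// -(signr_odd R i).
  case: odd; case: nth; rewrite ?expr0 ?expr1 /=.
  + by apply/eqP; ring.
  + by apply/negP => /eqP; lra.
  + by apply/eqP; ring.
  + by apply/negP => /eqP; lra.
- by rewrite lambda_penultimate eqxx sm2.
- by rewrite lambda_last eqxx sm3.
Qed.

End Coding.

Theorem theorem4p5 (R : realType) (n : nat) (hn : (1 <= n)%N) :
  (forall v : 'rV[R]_(ballot_dim n), @ballot_vertices R n v ->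
     size (alpha v) = (2 * n + 3)%N /\
     forall i : nat, (i < 2 * n + 3)%N ->
       ((alpha v)`_i = 0 \/ (alpha v)`_i = 1) /\
       (lambda v i = 1 \/ lambda v i = -1)) /\
  set_bij (@ballot_vertices R n) (bidirectional_ballot_sequences (2 * n + 3)%N)
    (@ballot_word R n).
Proof.
split=> [v /(vertex_zero_one hn) v01|].
  split=> [|i im]; first exact: size_alpha.
  by split; [exact: alpha_zero_one|exact: lambda_sign].
split=> [v Vv|v w /set_mem Vv /set_mem Vw vw|s [sn sb]].
- split; first by rewrite size_mkseq.
  apply/(ballot_polytope_word hn); first exact: vertex_zero_one.
  by case: Vv.
- rewrite -(ballot_wordK hn (vertex_zero_one hn Vv)) vw.
  by rewrite (ballot_wordK hn (vertex_zero_one hn Vw)).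
- exists (ballot_decode R n s); last exact: ballot_decodeK.
  apply: zero_one_vertex; last exact: zero_one_ballot_decode.
  apply/(ballot_polytope_word hn); first exact: zero_one_ballot_decode.
  by rewrite ballot_decodeK.
Qed.
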